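(* Let $I \subset R = K[\mathcal{A}]$ be a square-free monomial ideal and let $\mathcal{H} = \mathcal{H}(I) = (V,X,E,\mathcal{E})$ be its labeled hypergraph. Suppose that $\dim(\mathcal{H}) = 1$ and that there exist closed vertices $c_1,\ldots,c_t$ such that \begin{enumerate} \item for all $1 \le i, j \le t$, $c_i \notin N_{\mathcal{H}}(c_j)$; \item for every open vertex $v \in V$, there exists $1 \le i \le t$ such that $c_i \in N_{\mathcal{H}}(v)$; \item for all $1 \le i \le t$, there is a unique $a_i \in X$ with $E_{a_i} = \{c_i\}$. \end{enumerate} Then \[\mathrm{reg}(R/I) \ge |X| - |V|.\]
   Context: $K$ is a field, $\mathcal{A}$ is a finite set of symbols regarded as variables, and $R = K[\mathcal{A}]$ is the polynomial ring with the standard grading (every variable has degree one). For a finitely generated graded $R$-module $M$ with graded Betti numbers $\beta_{ij}(M)$ (so that the $i$th module of the minimal graded free resolution is $\bigoplus_j R(-j)^{\beta_{ij}(M)}$), $\mathrm{reg}(M) = \max\{j-i : \beta_{ij}(M)\neq 0 \text{ for some } i\}$. Labeled hypergraph of an ideal: let $I\subset R$ be a square-free monomial ideal with minimal monomial generating set $\{f_1,\ldots,f_\mu\}$. Its labeled hypergraph is $\mathcal{H}(I) = (V,X,E,\mathcal{E})$ where $V = \{1,\ldots,\mu\}$; $E$ is the function from $\mathcal{A}$ to the power set of $V$ given by $E_a = E(a) = \{j : a \text{ divides } f_j\}$; $X = \{a\in\mathcal{A} : E_a\neq\emptyset\}$; and $\mathcal{E} = \mathrm{Im}(E)$ is the set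 of edges. The dimension is $\dim(\mathcal{H}) = \max\{|F|-1 : F\in\mathcal{E}\}$. A vertex $v\in V$ is closed if $\{v\}\in\mathcal{E}$, and open otherwise. The set of neighbors of $v$ is $N_{\mathcal{H}}(v) = \{w\in V : w\neq v \text{ and there is } F\in\mathcal{E} \text{ with } v,w\in F\}$. *)

(* Defs.v *)
(* The finite set of variables A is
   'I_n, and a monomial is identified with its exponent vector 'X_{1..n}. *)
From HB Require Import structures.
From mathcomp Require Import all_boot all_order all_algebra.
From mathcomp Require Import mpoly.

Set Implicit Arguments.
Unset Strict Implicit.
Unset Printing Implicit Defensive.

Import Order.TTheory GRing.Theory Num.Theory.
Local Open Scope ring_scope.

Section MonomialIdeals.
Variables (K : fieldType) (n : nat).
Implicit Types (I : {mpoly K[n]} -> Prop) (S : 'X_{1..n} -> Prop).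

Definition mon_ideal S : {mpoly K[n]} -> Prop := fun p =>
  exists (k : nat) (q : 'I_k -> {mpoly K[n]}) (m : 'I_k -> 'X_{1..n}),
    (forall i, S (m i)) /\ p = \sum_(i < k) q i * 'X_[m i].

Definition squarefree_mon (m : 'X_{1..n}) : Prop :=
  forall a : 'I_n, (m a <= 1)%N.

Definition squarefree_monomial_ideal I : Prop :=
  exists S, (forall m, S m -> squarefree_mon m) /\
            (forall p, I p <-> mon_ideal S p).

(* f enumerates the minimal monomial generating set of I. The second clause
   forces f to be injective. *)
Definition minimal_generators I (mu : nat) (f : 'I_mu -> 'X_{1..n}) : Prop :=
  (forall p, I p <-> mon_ideal (fun m => exists j, m = f j) p) /\
  (forall j, ~ mon_ideal (fun m => exists2 i, i != j & m = f i) 'X_[f j]).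

End MonomialIdeals.

Section LabeledHypergraph.
Variables (A V : finType) (E : A -> {set V}).

Definition labels : {set A} := [set a | E a != set0].

Definition edges : {set {set V}} := [set E a | a in A].

(* -1 is a lower bound of all the values #|F| - 1, so this is their maximum
   (edges is empty only if A is). *)
Definition hdim : int :=
  \big[Order.max/(-1)]_(F in edges) (#|F|%:Z - 1).

Definition closed_vertex (v : V) : bool := [set v] \in edges.

Definition open_vertex (v : V) : bool := ~~ closed_vertex v.

Definition neighbors (v : V) : {set V} :=
  [set w | (w != v) && [exists F in edges, (v \in F) && (w \in F)]].

End LabeledHypergraph.

(* The edge map of the labeled hypergraph H(I) of the ideal with minimal
   monomial generators f. *)
Definition edge_map (n mu : nat) (f : 'I_mu -> 'X_{1..n}) (a : 'I_n) :
  {set 'I_mu} := [set j | (U_(a) <= f j)%MM].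

Section Regularity.
Variables (K : fieldType) (n : nat).
Local Notation R := {mpoly K[n]}.

(* The zero polynomial is homogeneous of every degree, and a nonzero one is
   never homogeneous of negative degree. *)
Definition homogeneous_of (d : int) (p : R) : Prop :=
  forall m, m \in msupp p -> (mdeg m)%:Z = d.

(* F_i is the sum over k < rk i of R(- shift i k), with elements written as row
   vectors; diff i : F_(i+1) -> F_i and the augmentation aug : F_0 -> R act by
   right multiplication. *)
Record graded_free_data := GradedFreeData {
  rk : nat -> nat;
  shift : forall i, 'I_(rk i) -> int;
  diff : forall i, 'M[R]_(rk i.+1, rk i);
  aug : 'cV[R]_(rk 0)
}.

(* The augmentation F_0 -> R/I is given through a homogeneous lift
   aug : F_0 -> R, which exists because F_0 is graded free. *)
Definition minimal_free_resolution (I : R -> Prop) (F : graded_free_data) :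
    Prop :=
  [/\ (* the maps are homogeneous of degree 0 *)
      (forall k, homogeneous_of (shift k) (aug F k 0)) /\
      (forall i k l,
         homogeneous_of (@shift F i.+1 k - @shift F i l) (diff F i k l)),
      (* F_0 -> R/I is surjective *)
      forall p : R, exists x : 'rV[R]_(rk F 0), I (p - (x *m aug F) 0 0),
      (* exactness at F_0 *)
      forall x : 'rV[R]_(rk F 0),
        I ((x *m aug F) 0 0) <->
        exists y : 'rV[R]_(rk F 1), x = y *m diff F 0,
      (* exactness at F_(i+1) *)
      forall i (x : 'rV[R]_(rk F i.+1)),
        x *m diff F i = 0 <->
        exists y : 'rV[R]_(rk F i.+2), x = y *m diff F i.+1
    & (* minimality: F_(i+1) maps into m F_i, with m the irrelevant maximal
         ideal *)
      forall i k l, (diff F i k l)@_0%MM = 0].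

(* beta_ij, for i : nat and j : int *)
Definition betti (F : graded_free_data) (i : nat) (j : int) : nat :=
  #|[set k : 'I_(rk F i) | shift k == j]|.

(* reg (R/I) = r. Minimal graded free resolutions are unique up to isomorphism,
   so r does not depend on F. *)
Definition is_regularity (I : R -> Prop) (r : int) : Prop :=
  exists F : graded_free_data,
    [/\ minimal_free_resolution I F,
        exists (i : nat) (j : int), betti F i j <> 0%N /\ r = j - i%:Z
      & forall (i : nat) (j : int), betti F i j <> 0%N -> j - i%:Z <= r].

End Regularity.

(* Main.v *)
Require Import Defs.
From HB Require Import structures.
From mathcomp Require Import all_boot all_order all_algebra.
From mathcomp Require Import mpoly.

Set Implicit Arguments.
Unset Strict Implicit.
Unset Printing Implicit Defensive.

Import Order.TTheory GRing.Theory Num.Theory.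
Local Open Scope ring_scope.

(** Let C = {c_1, ..., c_t}, let V' be the set of vertices outside C, let X'
    be the set of variables a whose edge E_a is not contained in C, and let m be
    the product of the variables in X'.  The generators of I that divide m are
    exactly the f_v with v in V': these divide m because they are squarefree,
    whereas the variable a_i divides f_(c_i) but not m.  Each f_v with v in V'
    has a private variable b_v, meaning that no other f_w with w in V' is
    divisible by b_v: if v is closed, take b_v with E_(b_v) = {v}; if v is open,
    it has a neighbour c_i, and as edges have at most two elements some variable
    has edge {v, c_i} ([private_label]).  So the Taylor resolution of the
    generators dividing m is minimal, its top generator has multidegree m, and
    the Betti number of R/I in homological degree |V'| and degree |X'| is
    nonzero ([top_betti_neq0]).  Hence reg(R/I) >= |X'| - |V'|.  Finally, an
    edge contained in C is a singleton {c_i} because the c_i are pairwise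
    non-adjacent, and then it carries a single variable; so at most |C|
    variables of X lie outside X' ([card_labels_le]) and
    |X'| - |V'| >= |X| - |C| - (|V| - |C|).

    The nonvanishing of the Betti number is read off from an arbitrary
    graded free resolution F, without comparing resolutions.  Write p = |V'| and
    let B be the set of the b_v.  In the Koszul complex with coefficients in
    R/I, the chain (m / x_B) e_B is a cycle.  To see that it is not a
    boundary, assign to each variable a of X' some v in V' with a | f_v.  Call S
    transversal if this assignment restricts to a bijection from S to V'.
    The functional taking the value 1 on (m / x_S) e_S for S transversal
    and 0 on the other basis elements vanishes on boundaries, provided that the
    variables are ordered so that the assignment is monotone
    ([coboundary_transversal]); and it takes the value 1 on the cycle.

    This pair (functional phi, cycle w) is moved through the double complex
    Koszul (x) F, one step at a time ([zigzag_cocycle], [zigzag_cycle]).  The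
    Koszul boundary of w is lifted along the differential F_(i+1) -> F_i; the
    functional phi is written as the coboundary of another functional, using the
    contraction of a simplex onto its smallest vertex ([cone_contraction]), and
    composed with the differential.  The value of phi on w never
    changes.  After p steps phi is a nonzero functional on F_p that kills
    all multiples of the variables and lives in degree |X'|, so
    F_p has a generator of degree |X'| ([koszul_class_shift]). *)

(** * Ordered cochains on the subsets of a finite set *)

Section Simplex.
Variables (T : finType) (rho : T -> nat).
Hypothesis rho_inj : injective rho.

(** The parity of this number is the sign with which the vertex [a] enters the
    oriented simplex [a |: S].  The order comes from [rho] rather than from an
    enumeration of [T], since the cocycle built later needs an order adapted to
    a partition of the vertices. *)
Definition rank_in (a : T) (S : {set T}) : nat :=
  #|[set s in S | (rho s < rho a)%N]|.

Lemma rank_inU1 a b (S : {set T}) :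
  b \notin S -> rank_in a (b |: S) = ((rho b < rho a)%N + rank_in a S)%N.
Proof.
move=> bS; rewrite /rank_in.
case: (boolP (rho b < rho a)%N) => [lt_ba|/negPf lt_ba].
  rewrite (_ : [set s in b |: S | (rho s < rho a)%N] =
      b |: [set s in S | (rho s < rho a)%N]).
    by rewrite cardsU1 inE (negPf bS).
  by apply/setP=> s; rewrite !inE; case: eqVneq => [->|//]; rewrite lt_ba.
rewrite add0n; apply: eq_card => s.
by rewrite !inE; case: eqVneq => [->|//]; rewrite lt_ba !andbF.
Qed.

(** Koszul boundary of a chain.  An element x^u e_S of the Koszul complex is
    recorded as the value x^u x_S at [S], that is, by its total multidegree; the
    factor x_a in the boundary of e_S is then absorbed and only signs remain. *)
Definition boundary (R : nzRingType) (M : lmodType R) (w : {set T} -> M)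
    (S : {set T}) : M :=
  \sum_(a | a \notin S) (-1) ^+ rank_in a S *: w (a |: S).

Definition coboundary (R : nzRingType) (g : {set T} -> R)
    (S : {set T}) : R :=
  \sum_(a in S) (-1) ^+ rank_in a (S :\ a) * g (S :\ a).

(** The pairs (a, b) and (b, a) contribute opposite terms.  They are matched
    explicitly, by splitting according to the order of [a] and [b], because in
    characteristic 2 a sum equal to its opposite need not vanish. *)
Lemma boundary_boundary (R : nzRingType) (M : lmodType R) (w : {set T} -> M) S :
  boundary (boundary w) S = 0.
Proof.
pose g a b := (-1) ^+ rank_in a S *:
  ((-1) ^+ rank_in b (a |: S) *: w (b |: (a |: S))).
have -> : boundary (boundary w) S =
    \sum_(a | a \notin S) \sum_(b | b \notin S)
      ((if (rho a < rho b)%N then g a b else 0) +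
       (if (rho b < rho a)%N then g a b else 0)).
  rewrite /boundary; apply: eq_bigr => a aS; rewrite scaler_sumr.
  rewrite [RHS](bigID (fun b => b == a)) /= [X in _ = X + _]big1 ?add0r.
    apply: eq_big => [b|b]; first by rewrite !inE negb_or andbC.
    rewrite !inE negb_or => /andP[ba _]; rewrite -/(g a b).
    have : rho a != rho b by rewrite (inj_eq rho_inj) eq_sym.
    by case: ltngtP => // _ _; rewrite ?addr0 ?add0r.
  by move=> b /andP[_ /eqP->]; rewrite ltnn addr0.
under eq_bigr => a _ do rewrite big_split.
rewrite big_split /= [X in _ + X]exchange_big /= -big_split /=.
apply: big1 => a aS; rewrite -big_split /=; apply: big1 => b bS.
case: ifP => [lt_ab|_]; last by rewrite addr0.
rewrite /g !rank_inU1 // lt_ab (ltnNge (rho b)) (ltnW lt_ab) /= add0n add1n.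
rewrite !scalerA -!exprD addnS exprS mulN1r scaleNr addnC setUCA.
by rewrite addNr.
Qed.

Lemma sum_boundary_adjoint (R : nzRingType) (M : lmodType R) (L : zmodType)
    (Phi : {set T} -> {additive M -> L}) (w : {set T} -> M) :
  \sum_S Phi S (boundary w S) =
  \sum_(S : {set T}) \sum_(a in S)
    Phi (S :\ a) ((-1) ^+ rank_in a (S :\ a) *: w S).
Proof.
under eq_bigr => S _ do rewrite raddf_sum.
rewrite (exchange_big_dep predT) //= [RHS](exchange_big_dep predT) //=.
apply: eq_bigr => a _.
rewrite (reindex_onto (fun S : {set T} => S :\ a)
  (fun S => a |: S)) /=; last first.
  by move=> S aS; rewrite setU1K.
apply: eq_big => [S|S /andP[_ /eqP aS]]; last first.
  by rewrite [X in w X]aS.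
rewrite !inE eqxx /=; apply/eqP/idP => [<-|aS]; first by rewrite !inE eqxx.
exact: setD1K.
Qed.

(** The full simplex on a nonempty set [U] is contractible: joining with a
    vertex [a] of [U] turns a cocycle into a cochain with coboundary [g]. Taking
    [a] smallest makes it come first in every simplex, so no sign appears. *)
Lemma cone_contraction (R : nzRingType) (U : {set T}) (a : T)
    (g : {set T} -> R) :
  a \in U -> (forall b, b \in U -> (rho a <= rho b)%N) ->
  (forall S : {set T}, S \subset U -> coboundary g S = 0) ->
  forall S : {set T}, S \subset U ->
    coboundary (fun S' => if a \in S' then 0 else g (a |: S')) S = g S.
Proof.
move=> aU a_min cg S SU.
have rank_a (S' : {set T}) : S' \subset U -> rank_in a S' = 0%N.
  move=> S'U; apply/eqP; rewrite cards_eq0; apply/eqP/setP=> s; rewrite !inE.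
  by apply/negP=> /andP[/(subsetP S'U)/a_min]; rewrite leqNgt => /negPf->.
rewrite /coboundary; case: (boolP (a \in S)) => aS.
  rewrite (bigD1 a) //= !inE eqxx /= setD1K // rank_a ?expr0 ?mul1r; last first.
    exact: subset_trans (subD1set _ _) SU.
  by rewrite big1 ?addr0 // => s /andP[_ sa]; rewrite !inE eq_sym sa aS mulr0.
have := cg (a |: S); rewrite /coboundary (bigD1 a) ?setU11 //= setU1K //.
rewrite rank_a // expr0 mul1r subUset sub1set aU SU => /(_ isT)/eqP.
rewrite addr_eq0 => /eqP->; rewrite -sumrN; apply: eq_big => [s|s sS].
  by rewrite !inE; case: eqVneq => [->|]; rewrite ?(negPf aS) ?andbT ?andbF.
have sa : s != a by apply: contraNneq aS => <-.
have aDS : a \notin S :\ s by rewrite !inE (negPf aS) andbF.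
rewrite (negPf aDS).
have -> : (a |: S) :\ s = a |: (S :\ s).
  by apply/setP=> x; rewrite !inE; case: eqVneq => [->|]; rewrite ?(negPf sa).
rewrite rank_inU1 // ltn_neqAle a_min ?(subsetP SU) // (inj_eq rho_inj).
by rewrite eq_sym sa /= add1n exprS mulN1r mulNr opprK.
Qed.

End Simplex.

(** * Linear functionals on free modules and divisibility by monomials *)

Section Functionals.
Variables (K : fieldType) (n : nat).
Local Notation R := {mpoly K[n]}.

(** The K-linear functional on R^N with value [g l u] at the basis element
    x^u e_l. *)
Definition pairing N (g : 'I_N -> 'X_{1..n} -> K) (y : 'rV[R]_N) : K :=
  \sum_l \sum_(u <- msupp (y 0 l)) (y 0 l)@_u * g l u.

(** Additivity of [pairing] needs the sums over the supports of different
    polynomials to be brought to a common index list. *)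
Lemma sum_msupp_widen (g : 'X_{1..n} -> K) (p : R) (s : seq 'X_{1..n}) :
  uniq s -> {subset msupp p <= s} ->
  \sum_(u <- msupp p) p@_u * g u = \sum_(u <- s) p@_u * g u.
Proof.
move=> s_uniq sub_s; rewrite [RHS](bigID (mem (msupp p))) /=.
rewrite [X in _ = _ + X]big1 ?addr0 => [|u]; last first.
  by rewrite mcoeff_msupp negbK => /eqP->; rewrite mul0r.
rewrite -[RHS]big_filter; apply: perm_big; apply: uniq_perm.
- exact: msupp_uniq.
- exact: filter_uniq.
move=> u; rewrite mem_filter /=; case: (boolP (u \in msupp p)) => // /sub_s.
by move->.
Qed.

Lemma pairing_is_additive N (g : 'I_N -> 'X_{1..n} -> K) :
  zmod_morphism (pairing g).
Proof.
move=> x y; rewrite /pairing -sumrB; apply: eq_bigr => l _; rewrite !mxE.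
set s := undup (msupp (x 0 l) ++ msupp (y 0 l)).
have s_uniq : uniq s by exact: undup_uniq.
rewrite !(@sum_msupp_widen _ _ s) //.
- by rewrite -sumrB; apply: eq_bigr => u _; rewrite mcoeffB mulrBl.
- by move=> u uy; rewrite mem_undup mem_cat uy orbT.
- by move=> u ux; rewrite mem_undup mem_cat ux.
- by move=> u; rewrite mem_undup => /msuppB_le.
Qed.

HB.instance Definition _ N g :=
  GRing.isZmodMorphism.Build 'rV[R]_N K (pairing g) (pairing_is_additive g).

Lemma pairingZ N (g : 'I_N -> 'X_{1..n} -> K) c y :
  pairing g (c%:MP *: y) = c * pairing g y.
Proof.
rewrite /pairing mulr_sumr; apply: eq_bigr => l _; rewrite !mxE.
rewrite (@sum_msupp_widen _ _ (msupp (y 0 l))) ?msupp_uniq //; last first.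
  by move=> u; rewrite !mcoeff_msupp mcoeffCM; apply: contraNneq => ->;
     rewrite mulr0.
by rewrite mulr_sumr; apply: eq_bigr => u _; rewrite mcoeffCM mulrA.
Qed.

Lemma pairing_sign N (g : 'I_N -> 'X_{1..n} -> K) k y :
  pairing g ((-1) ^+ k *: y) = (-1) ^+ k * pairing g y.
Proof. by rewrite -pairingZ rmorphXn /= rmorphN1. Qed.

Lemma eq_pairing N (g h : 'I_N -> 'X_{1..n} -> K) (y : 'rV[R]_N) :
  (forall l u, u \in msupp (y 0 l) -> g l u = h l u) ->
  pairing g y = pairing h y.
Proof.
move=> gh; apply: eq_bigr => l _; apply: eq_big_seq => u uy.
by rewrite gh.
Qed.

Lemma pairing_sum N (I : finType) (P : pred I) (c : I -> K)
    (g : I -> 'I_N -> 'X_{1..n} -> K) (y : 'rV[R]_N) :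
  \sum_(i | P i) c i * pairing (g i) y =
  pairing (fun l u => \sum_(i | P i) c i * g i l u) y.
Proof.
under eq_bigr => i _ do rewrite mulr_sumr.
rewrite exchange_big /=; apply: eq_bigr => l _.
under eq_bigr => i _ do rewrite mulr_sumr.
rewrite exchange_big /=; apply: eq_bigr => u _.
by rewrite mulr_sumr; apply: eq_bigr => i _; rewrite mulrCA.
Qed.

Lemma pairing_neq0 N (g : 'I_N -> 'X_{1..n} -> K) (y : 'rV[R]_N) :
  pairing g y != 0 -> exists l u, (y 0 l)@_u != 0 /\ g l u != 0.
Proof.
case: (boolP [exists l, has (fun u => g l u != 0) (msupp (y 0 l))]).
  by case/existsP=> l /hasP[u]; rewrite mcoeff_msupp => yu gu _; exists l, u.
rewrite negb_exists => /forallP g0 /eqP[]; apply: big1 => l _.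
apply: big1_seq => u /= yu; have /hasPn/(_ u yu) := g0 l.
by rewrite negbK => /eqP->; rewrite mulr0.
Qed.

(** The functional y |-> pairing g (y D), given by its values on the x^u e_k. *)
Definition pullback N M (g : 'I_N -> 'X_{1..n} -> K) (D : 'M[R]_(M, N))
    (k : 'I_M) (u : 'X_{1..n}) : K :=
  pairing g ('X_[u] *: row k D).

Lemma pairing_pullback N M (g : 'I_N -> 'X_{1..n} -> K) (D : 'M[R]_(M, N))
    (y : 'rV[R]_M) :
  pairing (pullback g D) y = pairing g (y *m D).
Proof.
rewrite mulmx_sum_row raddf_sum; apply: eq_bigr => k _.
rewrite [in RHS](mpolyE (y 0 k)) scaler_suml raddf_sum; apply: eq_bigr => u _.
by rewrite -mul_mpolyC -scalerA -pairingZ.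
Qed.

Definition supp (u : 'X_{1..n}) : {set 'I_n} := [set a | u a != 0%N].

Definition sqfree (S : {set 'I_n}) : 'X_{1..n} :=
  [multinom (a \in S : nat) | a < n].

Lemma sqfree_le S u : (sqfree S <= u)%MM = (S \subset supp u).
Proof.
apply/mnm_lepP/subsetP => [le_Su a aS|Su a].
  by have := le_Su a; rewrite mnmE aS inE lt0n.
by rewrite mnmE; case: (boolP (a \in S)) => // /Su; rewrite inE lt0n.
Qed.

Lemma mcoeffXM m u (q : R) :
  ('X_[m] * q)@_u = if (m <= u)%MM then q@_(u - m) else 0.
Proof.
rewrite mulrC; case: ifP => [le_mu|/negP nle_mu].
  by rewrite -{1}(submK le_mu) addmC mcoeffMX.
apply/eqP; rewrite mcoeff_eq0 (perm_mem (msuppMX _ _)).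
by apply/negP=> /mapP[v _ uE]; apply: nle_mu; rewrite uE lem_addr.
Qed.

Lemma sub_supp_msupp N S (y : 'rV[R]_N) l u :
  u \in msupp (('X_[sqfree S] *: y) 0 l) -> S \subset supp u.
Proof.
rewrite mxE mcoeff_msupp mcoeffXM sqfree_le.
by case: ifP; rewrite ?eqxx.
Qed.

(** Dividing an equation in a free module by a monomial: this is what allows
    relations to be lifted inside the multiples of a monomial. *)
Lemma mpolyXZI m N : injective (fun y : 'rV[R]_N => 'X_[m] *: y).
Proof.
move=> x y /= xy; apply/rowP=> l; apply/mpolyP=> u.
have /rowP/(_ l) := xy; rewrite !mxE => /(congr1 (mcoeff (m + u)%MM)).
by rewrite !mcoeffXM lem_addr (addmC m) addmK.
Qed.

Lemma mdeg_sqfree S : mdeg (sqfree S) = #|S|.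
Proof.
rewrite mdegE -sum1_card [RHS]big_mkcond /=; apply: eq_bigr => a _.
by rewrite mnmE; case: (a \in S).
Qed.

Lemma supp_sqfree S : supp (sqfree S) = S.
Proof. by apply/setP=> a; rewrite inE mnmE; case: (a \in S). Qed.

End Functionals.

(** * Moving a Koszul class along a free resolution *)

Section Zigzag.
Variables (K : fieldType) (n : nat) (rho : 'I_n -> nat).
Hypothesis rho_inj : injective rho.
Local Notation R := {mpoly K[n]}.

(** In multidegree [u] the Koszul complex of R is the augmented chain complex of
    the simplex on the support of [u]; the contraction therefore uses the
    smallest variable dividing x^u.  For u = 0 there is no such variable,
    which reflects that the homology K of the Koszul complex sits in
    multidegree 0. *)
Definition cone N (phi : {set 'I_n} -> 'I_N -> 'X_{1..n} -> K)
    (S : {set 'I_n}) (l : 'I_N) (u : 'X_{1..n}) : K :=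
  if [pick a in supp u | [forall b in supp u, (rho a <= rho b)%N]] is Some a
  then if a \in S then 0 else phi (a |: S) l u
  else 0.

Lemma coboundary_cone N (phi : {set 'I_n} -> 'I_N -> 'X_{1..n} -> K)
    (S : {set 'I_n}) l u :
  (forall S' : {set 'I_n}, S' \subset supp u ->
     coboundary rho (fun S'' => phi S'' l u) S' = 0) ->
  phi set0 l u = 0 -> S \subset supp u ->
  coboundary rho (fun S' => cone phi S' l u) S = phi S l u.
Proof.
move=> cphi phi0 Su; rewrite /cone.
case: pickP => [a /andP[au /forall_inP a_min]|no_a].
  exact: (cone_contraction rho_inj au a_min cphi Su).
suff u0 : supp u = set0.
  move: Su; rewrite u0 subset0 => /eqP->; rewrite phi0.
  by rewrite /coboundary big_set0.
apply/eqP/set0Pn=> -[a0 a0u].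
case: (arg_minnP rho a0u) => a au a_min; case/negP: (negbT (no_a a)).
by apply/andP; split; last exact/forall_inP.
Qed.

Variables (F : graded_free_data K n) (p : nat) (d : int).

(** A functional on Koszul_(p - i) (x) F_i, homogeneous of degree [d], that
    vanishes on Koszul boundaries and on the image of
    Koszul_(p - i) (x) F_(i+1).  As for chains, x^u e_S (x) e_l is recorded as
    x^u x_S e_l, so [phi S] only matters on multiples of x_S. *)
Definition koszul_cocycle i
    (phi : {set 'I_n} -> 'I_(rk F i) -> 'X_{1..n} -> K) :=
  [/\ forall S l u, phi S l u != 0 -> (#|S| + i)%N = p,
      forall S l u, phi S l u != 0 -> (mdeg u)%:Z + shift l = d,
      forall (S : {set 'I_n}) l u, S \subset supp u ->
        coboundary rho (fun S' => phi S' l u) S = 0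
    & forall S (y : 'rV[R]_(rk F i.+1)),
        pairing (phi S) (('X_[sqfree S] *: y) *m diff F i) = 0].

(** A chain whose Koszul boundary comes from F_(i+1). The lift is required to be
    divisible by x_S because it stands for an element of the Koszul complex at
    e_S. *)
Definition koszul_cycle i (w : {set 'I_n} -> 'rV[R]_(rk F i)) :=
  (forall S, exists y, w S = 'X_[sqfree S] *: y) /\
  (forall S, exists y, boundary rho w S = ('X_[sqfree S] *: y) *m diff F i).

Definition total_pairing N
    (phi : {set 'I_n} -> 'I_N -> 'X_{1..n} -> K)
    (w : {set 'I_n} -> 'rV[R]_N) : K :=
  \sum_S pairing (phi S) (w S).

Hypothesis F_homogeneous : forall i k l,
  homogeneous_of (@shift _ _ F i.+1 k - @shift _ _ F i l) (diff F i k l).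
Hypothesis F_exact : forall i (x : 'rV[R]_(rk F i.+1)),
  x *m diff F i = 0 <-> exists y : 'rV[R]_(rk F i.+2), x = y *m diff F i.+1.

(** Composing the contracted functional with the differential F_(i+1) -> F_i
    gives a cocycle: its coboundary is phi composed with the differential, which
    is zero by assumption on [phi]; and it kills the image of F_(i+2) since
    consecutive differentials compose to zero. *)
Lemma zigzag_cocycle i (phi : {set 'I_n} -> 'I_(rk F i) -> 'X_{1..n} -> K) :
  (i < p)%N -> koszul_cocycle phi ->
  koszul_cocycle (fun S => pullback (cone phi S) (diff F i)).
Proof.
move=> lt_ip [phi_size phi_deg phi_cocycle phi_kills].
have phi0 l u : phi set0 l u = 0.
  apply/eqP/negP=> /negP/phi_size; rewrite cards0 add0n => ip.
  by rewrite ip ltnn in lt_ip.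
have cone_neq0 S l u : cone phi S l u != 0 ->
    (#|S| + i.+1)%N = p /\ (mdeg u)%:Z + shift l = d.
  rewrite /cone; case: pickP => [a _|_]; last by rewrite eqxx.
  case: ifPn => [_|aS]; first by rewrite eqxx.
  move=> phi_neq0; split; last exact: phi_deg phi_neq0.
  by have := phi_size _ _ _ phi_neq0; rewrite cardsU1 aS add1n addSnnS.
split.
- by move=> S k u /pairing_neq0[l [v [_ /cone_neq0[]]]].
- move=> S k u /pairing_neq0[l [v [Duv /cone_neq0[_ <-]]]].
  move: Duv; rewrite !mxE mcoeffXM; case: ifP => [le_uv|_]; last first.
    by rewrite eqxx.
  rewrite -mcoeff_msupp => /F_homogeneous; rewrite -{2}(submK le_uv) mdegD.
  by rewrite PoszD => ->; rewrite [RHS]addrAC subrK addrC.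
- move=> S k u Su.
  have yE : 'X_[u] *: row k (diff F i) =
      ('X_[sqfree S] *: ('X_[u - sqfree S] *: delta_mx 0 k)) *m diff F i.
    rewrite scalerA -mpolyXD addmC submK ?sqfree_le // -scalemxAl.
    by rewrite -rowE.
  rewrite /coboundary /pullback pairing_sum -[RHS](phi_kills S
    ('X_[u - sqfree S] *: delta_mx 0 k)) -yE.
  apply: eq_pairing => l v; rewrite yE -scalemxAl => /sub_supp_msupp Sv.
  by apply: coboundary_cone => // S' S'v; apply: phi_cocycle.
move=> S y; rewrite pairing_pullback.
suff -> : ('X_[sqfree S] *: y) *m diff F i.+1 *m diff F i = 0.
  exact: raddf0.
by apply/F_exact; exists ('X_[sqfree S] *: y).
Qed.

(** The next chain w' is a lift of the boundary of w.  Its own boundary lifts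
    again since it is killed by the differential: the boundary of the boundary
    of w is zero.  The value is preserved because
    phi'(d w') = phi'(boundary w) = (coboundary phi')(w) = phi(w),
    where phi' is the contraction of phi. *)
Lemma zigzag_cycle i (phi : {set 'I_n} -> 'I_(rk F i) -> 'X_{1..n} -> K)
    (w : {set 'I_n} -> 'rV[R]_(rk F i)) :
  (i < p)%N -> koszul_cocycle phi -> koszul_cycle w ->
  exists w' : {set 'I_n} -> 'rV[R]_(rk F i.+1), koszul_cycle w' /\
    total_pairing (fun S => pullback (cone phi S) (diff F i)) w' =
    total_pairing phi w.
Proof.
move=> lt_ip [phi_size _ phi_cocycle _] [w_div w_lift].
have [y yE] := fin_all_exists w_lift.
pose w' S := 'X_[sqfree S] *: y S.
exists w'; split; first split.
- by move=> S; exists (y S).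
- move=> S.
  pose Y :=
    \sum_(a | a \notin S) (-1) ^+ rank_in rho a S *: ('X_a *: y (a |: S)).
  have bw' : boundary rho w' S = 'X_[sqfree S] *: Y.
    rewrite scaler_sumr; apply: eq_bigr => a aS.
    rewrite [RHS]scalerA [X in _ = X *: _]mulrC -[RHS]scalerA.
    congr (_ *: _); rewrite /w' scalerA -mpolyXD; congr ('X_[_] *: _).
    apply/mnmP=> b; rewrite !mnmE !inE (eq_sym b).
    by case: eqVneq => [<-|]; rewrite ?addn0 // (negPf aS).
  have Y0 : Y *m diff F i = 0.
    apply: (@mpolyXZI _ _ (sqfree S)); rewrite /= scaler0 scalemxAl -bw'.
    rewrite -(boundary_boundary rho_inj w S) mulmx_suml.
    by apply: eq_bigr => a aS; rewrite -scalemxAl yE.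
  have /F_exact[y' Y_E] := Y0.
  by exists y'; rewrite bw' Y_E scalemxAl.
rewrite /total_pairing.
under eq_bigr => S _ do rewrite pairing_pullback -yE.
rewrite sum_boundary_adjoint; apply: eq_bigr => S _.
under eq_bigr => a _ do rewrite /= pairing_sign.
rewrite pairing_sum; apply: eq_pairing => l u.
have [z ->] := w_div S; move=> /sub_supp_msupp Su.
apply: coboundary_cone => //; first by move=> S'; apply: phi_cocycle.
apply/eqP/negP=> /negP/phi_size; rewrite cards0 add0n => ip.
by rewrite ip ltnn in lt_ip.
Qed.

(** At the end of the zigzag the functional lives on F_p itself. Being a cocycle
    on singletons [set a], it kills every x_a F_p; so if it is nonzero, it is
    nonzero at some e_l, and homogeneity gives the degree of e_l. *)
Lemma koszul_class_shift (phi : {set 'I_n} -> 'I_(rk F 0) -> 'X_{1..n} -> K)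
    (w : {set 'I_n} -> 'rV[R]_(rk F 0)) :
  koszul_cocycle phi -> koszul_cycle w -> total_pairing phi w != 0 ->
  exists k : 'I_(rk F p), shift k = d.
Proof.
move=> phi_cocycle w_cycle phiw.
have zigzag i : (i <= p)%N -> exists (psi : {set 'I_n} -> _ -> _ -> K) v,
    [/\ @koszul_cocycle i psi, koszul_cycle v & total_pairing psi v != 0].
  elim: i => [_|i IHi lt_ip]; first by exists phi, w.
  have [psi [v [psi_c v_c psiv]]] := IHi (ltnW lt_ip).
  have [v' [v'_c psiv']] := zigzag_cycle lt_ip psi_c v_c.
  exists (fun S => pullback (cone psi S) (diff F i)), v'.
  by split; rewrite ?psiv' //; apply: zigzag_cocycle.
have [psi [v [[psi_size psi_deg psi_c _] _ psiv]]] := zigzag p (leqnn p).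
have [S _ ] : exists2 S, true & pairing (psi S) (v S) != 0.
  apply/exists_inP; apply: contra_neqT psiv; rewrite negb_exists_in.
  by move=> /forall_inP psi0; apply: big1 => S _; apply/eqP/negPn/psi0.
case/pairing_neq0=> l [u [_ psi_neq0]]; exists l.
(* Only the empty set has the size p - p allowed for [psi]. *)
have S0 : S = set0.
  apply/eqP; rewrite -cards_eq0; have /eqP := psi_size _ _ _ psi_neq0.
  by rewrite -[X in _ == X]add0n eqn_add2r.
suff u0 : u = 0%MM by have := psi_deg _ _ _ psi_neq0; rewrite u0 mdeg0 add0r.
apply/mnmP=> a; rewrite mnm0E; apply/eqP; apply: contraNT psi_neq0 => ua.
have : coboundary rho (fun S' => psi S' l u) [set a] = 0.
  by apply: psi_c; rewrite sub1set inE.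
move=> /eqP; rewrite /coboundary big_set1 setDv -S0 mulf_eq0.
by rewrite signr_eq0.
Qed.

End Zigzag.

(** * Monomial ideals and a nonvanishing Betti number *)

Section MonomialMembership.
Variables (K : fieldType) (n : nat).
Local Notation R := {mpoly K[n]}.

Lemma mon_idealP (S : 'X_{1..n} -> Prop) (p : R) :
  mon_ideal S p <->
  (forall u, u \in msupp p -> exists2 s, S s & (s <= u)%MM).
Proof.
split=> [[k [q [m [Sm ->]]]] u|p_supp].
  rewrite mcoeff_msupp raddf_sum /= => qm_neq0.
  have [i qmi] : exists i, (q i * 'X_[m i])@_u != 0.
    apply/existsP; apply: contra_neqT qm_neq0; rewrite negb_exists => /forallP.
    by move=> qm0; apply: big1 => i _; apply/eqP/negPn/qm0.
  exists (m i); first exact: Sm.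
  by move: qmi; rewrite mulrC mcoeffXM; case: ifP; rewrite ?eqxx.
have /fin_all_exists2[s Ss le_s] : forall i : 'I_(size (msupp p)),
    exists2 s, S s & (s <= tnth (in_tuple (msupp p)) i)%MM.
  by move=> i; apply: p_supp; apply: mem_tnth.
pose u i := tnth (in_tuple (msupp p)) i.
exists (size (msupp p)), (fun i => p@_(u i) *: 'X_[u i - s i]), s; split=> //.
rewrite [LHS]mpolyE (big_tnth _ _ (msupp p)); apply: eq_bigr => i _.
by rewrite -scalerAl -mpolyXD submK //; apply: le_s.
Qed.

End MonomialMembership.

Section TopBetti.
Variables (K : fieldType) (n mu : nat) (f : 'I_mu -> 'X_{1..n}).
Variable X : {set 'I_n}.
Local Notation R := {mpoly K[n]}.

Let V : {set 'I_mu} := [set v | (f v <= sqfree X)%MM].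

(* The generators dividing the monomial with support [X] have that monomial as
   least common multiple, and each of them has a private variable. *)
Hypothesis X_covered :
  forall a, a \in X -> exists v, (v \in V) && (f v a != 0%N).
Hypothesis V_private : forall v, v \in V -> exists a,
  f v a != 0%N /\ forall w, w \in V -> f w a != 0%N -> w = v.

(** A choice, for each variable in [X], of a generator in [V] that it divides.
    For a private variable there is no choice. *)
Definition block (a : 'I_n) : option 'I_mu := [pick v in V | f v a != 0%N].

(** The variables are ordered first by their block, so that within [X] each
    block is an interval. *)
Definition block_rank (a : 'I_n) : nat :=
  ((if block a is Some v then val v else 0) * n + a)%N.

Lemma block_rank_inj : injective block_rank.
Proof.
move=> a b /(congr1 (modn^~ n)); rewrite !modnMDl !modn_small //.
exact: val_inj.
Qed.

Lemma block_rank_lt a b v w : block a = Some v -> block b = Some w ->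
  v != w -> (block_rank a < block_rank b)%N = (v < w)%N.
Proof.
move=> av bw vw; rewrite /block_rank av bw.
have lt_blocks (i j : nat) (x y : 'I_n) :
    (i < j)%N -> (i * n + x < j * n + y)%N.
  move=> lt_ij; apply: (@leq_trans (i.+1 * n)).
    by rewrite mulSn addnC ltn_add2r.
  by rewrite (leq_trans _ (leq_addr _ _)) // leq_mul2r lt_ij orbT.
case: (ltngtP v w) => [lt_vw|lt_wv|/val_inj vwE].
- exact: lt_blocks.
- by apply/negbTE; rewrite -leqNgt ltnW // lt_blocks.
- by rewrite vwE eqxx in vw.
Qed.

Lemma block_X a : a \in X -> exists2 v, block a = Some v & f v a != 0%N.
Proof.
rewrite /block => /X_covered[v av]; case: pickP => [w /andP[_ aw]|/(_ v)].
  by exists w.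
by rewrite av.
Qed.

Lemma blockP a v : block a = Some v -> (v \in V) && (f v a != 0%N).
Proof. by rewrite /block; case: pickP => // w aw [<-]. Qed.

Definition transversal (S : {set 'I_n}) : bool :=
  [&& S \subset X, #|S| == #|V| &
      [forall v in V, exists a in S, block a == Some v]].

(** The image of the block map contains [V], which has as many elements as S. *)
Lemma transversal_inj (S : {set 'I_n}) :
  transversal S -> {in S &, injective block}.
Proof.
case/and3P=> _ /eqP cardS /forall_inP V_S; apply/imset_injP.
rewrite eqn_leq leq_imset_card /= cardS.
rewrite -(card_imset (mem V) (@Some_inj _)); apply/subset_leq_card/subsetP.
move=> _ /imsetP[v vV ->]; have /exists_inP[a aS /eqP <-] := V_S v vV.
exact: imset_f.
Qed.

Lemma transversal_swap (S : {set 'I_n}) a b :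
  a \in S -> b \in S -> a != b -> block a = block b ->
  S \subset X -> transversal (S :\ a) -> transversal (S :\ b).
Proof.
move=> aS bS ab blk SX /and3P[_ /eqP cardS /forall_inP V_S]; apply/and3P; split.
- exact: subset_trans (subD1set _ _) SX.
- have := cardsD1 a S; rewrite aS (cardsD1 b S) bS => /eqP.
  by rewrite eqn_add2l cardS.
apply/forall_inP=> v /V_S/exists_inP[s]; rewrite !inE => /andP[sa sS] sv.
have [sb|sb] := eqVneq s b; apply/exists_inP.
  by exists a; rewrite ?inE ?ab ?aS // blk -sb.
by exists s; rewrite // !inE sb.
Qed.

(** If some S minus a is transversal, then a shares its block with exactly one
    other element b of S, and a and b are the only elements whose removal leaves
    a transversal set.  No element of S lies between a and b, since blocks are
    intervals; so the two terms have opposite signs. *)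
Lemma coboundary_transversal (S : {set 'I_n}) : S \subset X ->
  coboundary block_rank (fun S' => (transversal S')%:R : K) S = 0.
Proof.
move=> SX; rewrite /coboundary.
have [/exists_inP[a aS tra]|no_tr] :=
    boolP [exists a in S, transversal (S :\ a)]; last first.
  apply: big1 => a aS; rewrite (negPf (_ : ~~ transversal (S :\ a))) ?mulr0 //.
  by apply: contra no_tr => tra; apply/exists_inP; exists a.
have [v av fva] := block_X (subsetP SX a aS).
have vV : v \in V by case/andP: (blockP av).
have /and3P[_ _ /forall_inP/(_ v vV)/exists_inP[b]] := tra.
rewrite !inE => /andP[ba bS] /eqP bv.
have trb : transversal (S :\ b).
  by apply: transversal_swap aS bS _ _ SX tra; rewrite 1?eq_sym // av bv.
rewrite (bigD1 a) //= (bigD1 b) /=; last by rewrite bS.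
rewrite tra trb !mulr1 big1 ?addr0; last first.
  move=> s /andP[/andP[sS sa] sb].
  rewrite (negPf (_ : ~~ transversal (S :\ s))) ?mulr0 //.
  apply/negP=> /transversal_inj/(_ a b); rewrite !inE.
  rewrite aS bS av bv ![_ == s]eq_sym sa sb => /(_ isT isT erefl) ab.
  by rewrite ab eqxx in ba.
pose S2 := S :\ a :\ b.
have bS2 : b \notin S2 by rewrite !inE eqxx.
have aS2 : a \notin S2 by rewrite !inE eqxx andbF.
have -> : S :\ a = b |: S2 by rewrite setD1K // !inE ba bS.
have -> : S :\ b = a |: S2.
  have -> : S2 = S :\ b :\ a by rewrite /S2 !setDDl setUC.
  by rewrite setD1K // !inE eq_sym ba aS.
rewrite !rank_inU1 //.
have -> : rank_in block_rank a S2 = rank_in block_rank b S2.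
  apply: eq_card => s; rewrite [LHS]inE [RHS]inE.
  case: (boolP (s \in S2)) => //= sS2.
  have [sb sa sS] : [/\ s != b, s != a & s \in S].
    by move: sS2; rewrite !inE => /and3P[].
  have [w sw _] := block_X (subsetP SX s sS).
  have wv : w != v.
    apply: contraNneq sb => wv; apply/eqP.
    by apply: (transversal_inj tra); rewrite ?inE ?sa ?ba // sw bv wv.
  by rewrite (block_rank_lt sw av wv) (block_rank_lt sw bv wv).
have : block_rank a != block_rank b.
  by rewrite (inj_eq block_rank_inj) eq_sym.
by case: ltngtP => // _ _; rewrite add1n add0n exprS mulN1r ?addrN ?addNr.
Qed.

(** A transversal set contains a variable of every generator dividing m, so
    m / x_S is not in the ideal: the cocycle is well defined modulo I. *)
Lemma transversal_indivisible (S : {set 'I_n}) j :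
  transversal S -> ~~ (f j <= sqfree X - sqfree S)%MM.
Proof.
case/and3P=> _ _ /forall_inP V_S; apply/negP=> le_jXS.
have jV : j \in V by rewrite inE (lepm_trans le_jXS) ?lem_subr.
have /exists_inP[a aS /eqP/blockP/andP[_ fja]] := V_S j jV.
have := mnm_lepP le_jXS a; rewrite !mnmE aS.
by case: (a \in X); rewrite leqn0 (negPf fja).
Qed.

(** The set of private variables is transversal; and since the only private
    variable dividing f_v is its own b_v, putting b_v back into m / x_B gives
    a multiple of f_v.  This makes (m / x_B) e_B a Koszul cycle modulo I. *)
Lemma private_transversal : exists B : {set 'I_n},
  transversal B /\
  forall a, a \in B -> exists v, (f v <= sqfree X - sqfree (B :\ a))%MM.
Proof.
(* Indexing by the subtype of V spares a default variable outside V. *)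
have /fin_all_exists[b b_private] : forall v : {v | v \in V}, exists a,
    f (val v) a != 0%N /\ forall w, w \in V -> f w a != 0%N -> w = val v.
  by move=> v; apply: V_private; apply: valP.
have b_inj : injective b.
  move=> v w bvw; apply: val_inj; have [fw _] := b_private v.
  by apply: (b_private w).2; [apply: valP|rewrite -bvw].
have bX v : b v \in X.
  have : val v \in V by apply: valP.
  rewrite inE => /mnm_lepP/(_ (b v)); rewrite mnmE; case: (b v \in X) => //.
  by rewrite leqn0 (negPf (b_private v).1).
exists [set b v | v in {: {v | v \in V}}].
split; first apply/and3P; first split.
- by apply/subsetP=> _ /imsetP[v _ ->].
- by rewrite card_imset // card_sig; apply/eqP/eq_card.
- apply/forall_inP=> v vV; apply/exists_inP; exists (b (Sub v vV)).
    exact: imset_f.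
  have [w bw fw] := block_X (bX (Sub v vV)); rewrite bw.
  have /andP[wV _] := blockP bw.
  by rewrite ((b_private (Sub v vV)).2 w wV fw).
move=> _ /imsetP[v _ ->]; exists (val v); apply/mnm_lepP=> a.
have : val v \in V by apply: valP.
rewrite inE => /mnm_lepP/(_ a); rewrite !mnmE !inE.
case: (boolP (_ && _)) => [|_]; last by rewrite subn0.
case/andP=> neq_ab /imsetP[w _ aw] _; rewrite leqNgt; apply/negP => lt0.
have fva : f (val v) a != 0%N by rewrite -lt0n (leq_ltn_trans _ lt0).
rewrite aw in fva neq_ab; have := (b_private w).2 _ (valP v) fva.
by move/val_inj => vw; rewrite vw eqxx in neq_ab.
Qed.

Lemma pairing_mcoeff c m (z : 'rV[R]_1) :
  pairing (fun _ u => c * (u == m)%:R) z = c * (z 0 0)@_m.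
Proof.
rewrite /pairing big_ord1; case: (boolP (m \in msupp (z 0 0))) => [mz|mz].
  rewrite (bigD1_seq m) ?msupp_uniq //= eqxx mulr1 big1 ?addr0 1?mulrC //.
  by move=> u /negPf->; rewrite !mulr0.
rewrite memN_msupp_eq0 // mulr0; apply: big1_seq => u /= uz.
by case: eqVneq => [um|_]; rewrite ?mulr0 // -um uz in mz *.
Qed.

Variables (I : R -> Prop) (F : graded_free_data K n).
Hypothesis I_supp :
  forall p, I p <-> forall u, u \in msupp p -> exists j, (f j <= u)%MM.
Hypothesis F_res : minimal_free_resolution I F.

(** The Betti number given by the top of the Taylor resolution of the generators
    dividing the monomial with support [X]. *)
Lemma top_betti_neq0 : betti F #|V| #|X|%:Z <> 0%N.
Proof.
have [[aug_hom diff_hom] aug_onto exact0 exactS _] := F_res.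
pose m := sqfree X; pose lam S : K := (transversal S)%:R.
pose phi S := pullback (fun _ u => lam S * (u == m)%:R) (aug F).
have phiE S l u : phi S l u = lam S * ('X_[u] * aug F l 0)@_m.
  by rewrite /phi /pullback pairing_mcoeff !mxE.
have lam_neq0 S c : lam S * c != 0 -> transversal S.
  by rewrite /lam; case: (transversal S); rewrite ?mul0r ?eqxx.
have phi_c : koszul_cocycle block_rank #|V| #|X|%:Z phi.
  split.
  - by move=> S l u; rewrite phiE addn0 => /lam_neq0/and3P[_ /eqP].
  - move=> S l u; rewrite phiE mulf_eq0 negb_or mcoeffXM => /andP[_].
    case: ifP => [le_um|]; rewrite ?eqxx // -mcoeff_msupp => /aug_hom <-.
    by rewrite -PoszD -mdegD addmC submK // mdeg_sqfree.
  - move=> S l u Su; rewrite /coboundary.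
    under eq_bigr => a _ do rewrite phiE mulrA.
    rewrite -mulr_suml mcoeffXM; case: ifP => le_um; last first.
      by rewrite mulr0.
    rewrite [X in X * _](_ : _ = 0) ?mul0r //; apply: coboundary_transversal.
    rewrite -(supp_sqfree X); apply: (subset_trans Su); apply/subsetP=> a.
    by rewrite !inE -!lt0n => /leq_trans; apply; apply: (mnm_lepP le_um).
  move=> S y; rewrite pairing_pullback pairing_mcoeff -!scalemxAl mxE mcoeffXM.
  case: ifP => [_|_]; last by rewrite mulr0.
  apply/eqP; apply: contraT => lamq; have trS := lam_neq0 _ _ lamq.
  move: lamq; rewrite mulf_eq0 negb_or => /andP[_]; rewrite -mcoeff_msupp.
  have /I_supp qI : I ((y *m diff F 0 *m aug F) 0 0) by apply/exact0; exists y.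
  by case/qI=> j; apply: contraTT => _; apply: transversal_indivisible.
have [B [trB B_lift]] := private_transversal.
(* [x0] is a lift to F_0 of the unit of R/I, so [w] lifts (m / x_B) e_B. *)
have [x0 x0I] := aug_onto 1.
pose w S := if S == B then 'X_[m] *: x0 else 0.
have split_m (S : {set 'I_n}) (y : 'rV[R]_(rk F 0)) : S \subset X ->
    'X_[m] *: y = 'X_[sqfree S] *: ('X_[m - sqfree S] *: y).
  by move=> SX; rewrite scalerA -mpolyXD addmC submK // sqfree_le supp_sqfree.
have BX : B \subset X by case/and3P: trB.
have w_c : koszul_cycle block_rank w.
  split=> S.
    rewrite /w; case: eqP => [->|_]; last by exists 0; rewrite scaler0.
    by exists ('X_[m - sqfree B] *: x0); apply: split_m.
  have [/exists_inP[a aB /eqP SE]|no_a] := boolP [exists a in B, S == B :\ a].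
    have SX : S \subset X by rewrite SE (subset_trans (subD1set _ _)).
    have aS : a \notin S by rewrite SE !inE eqxx.
    pose s : R := (-1) ^+ rank_in block_rank a S.
    have [|y yE] := (exact0 (s *: ('X_[m - sqfree S] *: x0))).1.
      rewrite scalerA mulrC -scalerA -scalemxAl mxE; apply/I_supp => u.
      rewrite mcoeff_msupp mcoeffXM; case: ifP => [le_u _|]; last first.
        by rewrite eqxx.
      have [v le_v] := B_lift a aB; exists v; rewrite SE in le_u.
      exact: lepm_trans le_v le_u.
    exists y; rewrite -scalemxAl -yE /boundary (bigD1 a) //= big1 ?addr0.
      rewrite /w (_ : a |: S = B) ?eqxx; last by rewrite SE setD1K.
      rewrite (split_m S) // [RHS]scalerA [X in _ = X *: _]mulrC.
      by rewrite -[RHS]scalerA.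
    move=> b /andP[bS ba]; rewrite /w; case: eqP; last by rewrite scaler0.
    move=> bSE; have := aB; rewrite -bSE !inE (negPf aS) orbF eq_sym.
    by rewrite (negPf ba).
  exists 0; rewrite scaler0 mul0mx; apply: big1 => a aS.
  rewrite /w; case: eqP => [aSB|_]; last by rewrite scaler0.
  case/exists_inP: no_a; exists a; first by rewrite -aSB setU11.
  by rewrite -aSB setU1K.
have phiw : total_pairing phi w != 0.
  rewrite /total_pairing (bigD1 B) //= big1 ?addr0; last first.
    by move=> S /negPf SB; rewrite /w SB raddf0.
  rewrite /w eqxx pairing_pullback pairing_mcoeff /lam trB mul1r.
  rewrite -scalemxAl mxE mcoeffXM lepm_refl.
  have -> : (m - m = 0)%MM by apply/mnmP=> a; rewrite mnmBE subnn mnm0E.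
  suff : (1 - (x0 *m aug F) 0 0)@_0%MM == 0.
    rewrite mcoeffB mcoeff1 eqxx subr_eq0 => /eqP <-; exact: oner_neq0.
  apply: contraT; rewrite -mcoeff_msupp => /(I_supp _).1 - /(_ x0I)[j le_j0].
  have jV : j \in V.
    by rewrite inE; apply/mnm_lepP=> a;
       rewrite (leq_trans (mnm_lepP le_j0 a)) ?mnm0E.
  have [a [fja _]] := V_private jV.
  by have := mnm_lepP le_j0 a; rewrite mnm0E leqn0 (negPf fja).
have [k kE] := koszul_class_shift block_rank_inj diff_hom exactS phi_c w_c phiw.
by apply/eqP; rewrite cards_eq0; apply/set0Pn; exists k; rewrite inE kE.
Qed.

End TopBetti.

(** * The labeled hypergraph *)

Section Generators.
Variables (K : fieldType) (n mu : nat) (I : {mpoly K[n]} -> Prop).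
Variable f : 'I_mu -> 'X_{1..n}.
Hypothesis f_gen : minimal_generators I f.

Lemma minimal_generatorsP p :
  I p <-> forall u, u \in msupp p -> exists j, (f j <= u)%MM.
Proof.
rewrite f_gen.1 mon_idealP; split=> p_supp u /p_supp.
  by case=> _ [j ->]; exists j.
by case=> j le_ju; exists (f j) => //; exists j.
Qed.

(** A minimal generator is divisible by a squarefree element of I, which is in
    turn divisible by a minimal generator; by minimality all three agree. *)
Lemma minimal_generators_squarefree j :
  squarefree_monomial_ideal I -> squarefree_mon (f j).
Proof.
case=> S [S_sqf S_gen].
have mem_X u : u \in msupp ('X_[f j] : {mpoly K[n]}) -> u = f j.
  by move/mem_msuppXP.
have : I 'X_[f j].
  by apply/minimal_generatorsP=> u /mem_X->; exists j; apply: lepm_refl.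
move/S_gen/mon_idealP/(_ (f j)); rewrite msuppX mem_head => /(_ isT)[s Ss le_s].
have : I 'X_[s].
  apply/S_gen/mon_idealP=> u /mem_msuppXP <-.
  by exists s; rewrite ?lepm_refl.
move/minimal_generatorsP/(_ s); rewrite msuppX mem_head => /(_ isT)[i le_i].
have [ij|neq_ij] := eqVneq i j.
  by rewrite ij in le_i => a; rewrite (leq_trans (mnm_lepP le_i a)) // S_sqf.
case: (f_gen.2 j); apply/mon_idealP=> u /mem_X->.
by exists (f i); [exists i|apply: lepm_trans le_i le_s].
Qed.

End Generators.

Lemma card_edge_le (A V : finType) (E : A -> {set V}) a :
  #|E a|%:Z - 1 <= hdim E.
Proof.
apply: (Order.TotalTheory.le_bigmax_cond (-1) (fun G : {set V} => #|G|%:Z - 1)).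
exact: imset_f.
Qed.

Section DominatingClosedVertices.
Variables (A V : finType) (E : A -> {set V}) (C : {set V}).

(** The edge {v} of a closed vertex, or an edge joining an open vertex to [C]:
    in either case [v] is its only vertex outside [C]. *)
Lemma private_label v : hdim E <= 1 -> v \notin C ->
  (open_vertex E v -> exists2 w, w \in C & w \in neighbors E v) ->
  exists2 a, v \in E a & E a \subset v |: C.
Proof.
move=> hdim1 vC v_dom.
have [/v_dom[w wC]|] := boolP (open_vertex E v); last first.
  rewrite negbK => /imsetP[a _ vE]; exists a; rewrite -vE ?set11 //.
  by rewrite sub1set setU11.
rewrite inE => /andP[wv /exists_inP[G /imsetP[a _ ->] /andP[va wa]]].
exists a => //; apply/subsetP=> x xa; rewrite !inE.
apply: contraT; rewrite negb_or => /andP[xv xC].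
have : (#|[set v; w; x]| <= #|E a|)%N.
  apply/subset_leq_card/subsetP=> y.
  by rewrite !inE => /orP[/orP[]|] /eqP->.
have xw : x != w by apply: contraNneq xC => ->.
have -> : #|[set v; w; x]| = 3%N.
  by rewrite setUC !cardsU1 cards1 !inE (negPf xv) (negPf xw) eq_sym wv.
have := le_trans (card_edge_le E a) hdim1.
by rewrite lerBlDr -[1 + 1]/(2%:Z) lez_nat => le2 /leq_trans/(_ le2).
Qed.

(** A nonempty edge inside [C] is a singleton, and distinct labels of this kind
    have distinct edges. *)
Lemma card_labels_le : {in C &, forall v w, v \notin neighbors E w} ->
  {in C, forall v a b, E a = [set v] -> E b = [set v] -> a = b} ->
  (#|labels E| <= #|[set a | ~~ (E a \subset C)]| + #|C|)%N.
Proof.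
move=> C_indep C_uniq; set X := [set a | _].
have E_single a : a \in labels E :\: X -> exists2 v, v \in C & E a = [set v].
  rewrite !inE negbK => /andP[/subsetP aC /set0Pn[v va]].
  exists v; first exact: aC.
  apply/setP=> w; rewrite inE; apply/idP/eqP => [wa|->//].
  apply: contraTeq (C_indep w v (aC w wa) (aC v va)) => wv.
  rewrite negbK inE wv; apply/exists_inP; exists (E a); first exact: imset_f.
  by rewrite va wa.
rewrite -(cardsID X (labels E)) leq_add //.
  by rewrite subset_leq_card // subsetIr.
have E_inj : {in labels E :\: X &, injective E}.
  move=> a b /E_single[v vC av] _ abE.
  by apply: (C_uniq v); rewrite // -abE.
rewrite -(card_in_imset E_inj) (leq_trans _ (leq_imset_card set1 C)) //.
apply/subset_leq_card/subsetP=> _ /imsetP[a /E_single[v vC ->] ->].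
exact: imset_f.
Qed.

End DominatingClosedVertices.

Theorem proposition5p2 (K : fieldType) (n : nat) (I : {mpoly K[n]} -> Prop)
    (mu : nat) (f : 'I_mu -> 'X_{1..n})
    (hI : squarefree_monomial_ideal I)
    (hf : minimal_generators I f)
    (hdim1 : hdim (edge_map f) = 1)
    (t : nat) (c : 'I_t -> 'I_mu)
    (hclosed : forall i, closed_vertex (edge_map f) (c i))
    (hindep : forall i j, c i \notin neighbors (edge_map f) (c j))
    (hopen : forall v : 'I_mu, open_vertex (edge_map f) v ->
       exists i, c i \in neighbors (edge_map f) v)
    (huniq : forall i, exists! a : 'I_n,
       a \in labels (edge_map f) /\ edge_map f a = [set c i])
    (r : int) (hr : is_regularity I r) :
  #|labels (edge_map f)|%:Z - mu%:Z <= r.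
Proof.
have [F [F_res _ le_r]] := hr.
set E := edge_map f in hdim1 hclosed hindep hopen huniq *.
pose C := [set c i | i in 'I_t].
pose X := [set a | ~~ (E a \subset C)].
have mem_E v a : (v \in E a) = (f v a != 0%N) by rewrite inE lep1mP.
(* The generators dividing the product of [X] are those outside [C]. *)
have le_X v : (f v <= sqfree X)%MM = (v \notin C).
  apply/mnm_lepP/idP => [le_v|vC a].
    apply/imsetP=> -[i _ vi]; have [a [[_ aE] _]] := huniq i.
    have := le_v a; rewrite mnmE inE aE sub1set imset_f //= leqn0.
    by rewrite -[_ == _]negbK -mem_E aE vi set11.
  rewrite mnmE inE; case: (boolP (E a \subset C)) => [/subsetP aC|_].
    by rewrite leqn0 -[_ == _]negbK -mem_E; apply: contra vC => /aC.
  exact: (minimal_generators_squarefree hf).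
have X_covered a : a \in X ->
    exists v, (v \in [set v | (f v <= sqfree X)%MM]) && (f v a != 0%N).
  rewrite inE => /subsetPn[v va vC]; exists v.
  by rewrite inE le_X vC -mem_E.
have V_private v : v \in [set v | (f v <= sqfree X)%MM] -> exists a,
    f v a != 0%N /\
    forall w, w \in [set v | (f v <= sqfree X)%MM] -> f w a != 0%N -> w = v.
  rewrite inE le_X => vC.
  have [|/hopen[i vi]|a va /subsetP aC] := @private_label _ _ E C v _ vC.
  - by rewrite hdim1.
  - by exists (c i) => //; apply: imset_f.
  exists a; rewrite -mem_E; split=> // w; rewrite inE le_X -mem_E => wC /aC.
  by rewrite !inE (negPf wC) orbF => /eqP.
have := le_r _ _
  (top_betti_neq0 X_covered V_private (minimal_generatorsP hf) F_res).
apply: le_trans.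
have -> : #|[set v | (f v <= sqfree X)%MM]| = #|~: C|.
  by apply: eq_card => v; rewrite !inE le_X.
have : (#|labels E| <= #|X| + #|C|)%N.
  apply: card_labels_le => [v w /imsetP[i _ ->] /imsetP[j _ ->]|] //.
  move=> v /imsetP[i _ ->] a b aE bE; have [x [_ x_uniq]] := huniq i.
  have E_label y : E y = [set c i] -> x = y.
    move=> yE; apply: x_uniq; split=> //; rewrite inE yE.
    by apply/set0Pn; exists (c i); rewrite set11.
  by rewrite -(E_label a aE) (E_label b bE).
have -> : mu%:Z = #|C|%:Z + #|~: C|%:Z by rewrite -PoszD cardsC card_ord.
rewrite -lez_nat PoszD => le_XC.
by rewrite lerBlDr addrA [_ - _ + _]addrAC subrK.
Qed.
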